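(* For every $n\ge 0$, the map $\phi$ is a bijection from the set of Motzkin paths of length $2n+1$ to the set of paths in $\mathcal{A}^{Q}$ of horizontal length $n$, and also from the set of Grand Motzkin paths of length $2n+1$ to the set of paths in $\mathcal{A}^{H}$ of horizontal length $n$; its inverse is $\psi$.
   Context: A lattice path is a finite sequence of steps (vectors in $\mathbb{Z}^2$) starting at $(0,0)$; its vertices are the partial sums. Let $S_{M}=\{(1,0),(1,1),(1,-1)\}$ and $S_{MW}=S_M\cup\{(0,1),(0,-1)\}$; $(0,\pm1)$ are vertical steps. A Grand Motzkin path of length $L$ is a lattice path of $L$ steps from $S_M$ (any endpoint); a Motzkin path of length $L$ is a Grand Motzkin path of length $L$ all of whose vertices have $y\ge0$. A vertically constrained $S_{MW}$ path is a lattice path with steps in $S_{MW}$ with no two consecutive vertical steps; its horizontal length is the $x$-coordinate of its endpoint. $\mathcal{A}^{H}$ is the set of all vertically constrained $S_{MW}$ paths, and $\mathcal{A}^{Q}$ the subset of those all of whose vertices have $y\ge 0$. The map $\phi$ acts on a path with steps $e_1,\dots,e_{2n+1}$ by modifying each step $e_i$ with $i$ odd: $(1,1)\mapsto(0,1)$, $(1,-1)\mapsto(0,-1)$, and $(1,0)$ is deleted; steps with even index are kept. The map $\psi$ acts on a vertically constrained $S_{MW}$ path of horizontal length $n$ as follows: for each $i\in\{0,1,\dots,n\}$ (there is at most one vertical step at $x$-coordinate $i$), if there is a vertical step at $x=i$, replace $(0,1)$ by $(1,1)$ and $(0,-1)$ by $(1,-1)$; otherwise insert a step $(1,0)$ at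 the vertex with $x$-coordinate $i$ (subsequent steps being shifted accordingly). *)

(* Defs.v *)
From mathcomp Require Export all_boot all_order all_algebra.
From mathcomp Require Export boolp classical_sets functions.

Set Implicit Arguments.
Unset Strict Implicit.
Unset Printing Implicit Defensive.

Import Order.TTheory GRing.Theory Num.Theory.

Local Open Scope classical_set_scope.
Local Open Scope ring_scope.

Definition step : Type := (int * int)%type.

Definition lattice_path : Type := seq step.

Definition S_M : seq step := [:: (1, 0); (1, 1); (1, -1)].

Definition S_MW : seq step := S_M ++ [:: (0, 1); (0, -1)].

Definition vertical (e : step) : bool := e \in [:: (0, 1); (0, -1)].

Definition vertex (p : lattice_path) (k : nat) : int * int := \sum_(e <- take k p) e.

Definition vertices (p : lattice_path) : seq (int * int) :=
  [seq vertex p k | k <- iota 0 (size p).+1].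

Definition nonneg_path (p : lattice_path) : Prop :=
  forall v, v \in vertices p -> 0 <= v.2.

Definition hlength (p : lattice_path) : int := (vertex p (size p)).1.

Definition grand_motzkin (L : nat) : set lattice_path :=
  [set p | size p = L /\ {subset p <= S_M}].

Definition motzkin (L : nat) : set lattice_path :=
  [set p | grand_motzkin L p /\ nonneg_path p].

Definition A_H : set lattice_path :=
  [set p | {subset p <= S_MW} /\
    forall k : nat, (k.+1 < size p)%N ->
      ~ (vertical (nth 0 p k) /\ vertical (nth 0 p k.+1))].

Definition A_Q : set lattice_path := [set p | A_H p /\ nonneg_path p].

(* The value is a sequence so that the step (1,0) can be deleted; the last
   branch is never reached on steps of S_M. *)
Definition phi_step (e : step) : seq step :=
  if e == (1, 1) then [:: (0, 1)]
  else if e == (1, -1) then [:: (0, -1)]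
  else if e == (1, 0) then [::]
  else [:: e].

(* The 1-based step e_i is nth 0 p i.-1. *)
Definition phi (p : lattice_path) : lattice_path :=
  flatten [seq (let e := nth 0 p i.-1 in
                if odd i then phi_step e else [:: e])
          | i <- iota 1 (size p)].

Definition psi_step (e : step) : step :=
  if e == (0, 1) then (1, 1)
  else if e == (0, -1) then (1, -1)
  else e.

Definition steps_from (p : lattice_path) (i : nat) : seq step :=
  [seq nth 0 p k | k <- iota 0 (size p) & (vertex p k).1 == i%:Z].

(* When no vertical step lies on the line x = i, the path has a single vertex
   there, and inserting (1,0) at it means inserting it in front of the steps
   that leave from it. *)
Definition psi_block (p : lattice_path) (i : nat) : seq step :=
  if has vertical (steps_from p i) then map psi_step (steps_from p i)
  else (1, 0) :: steps_from p i.

(* absz (hlength p) is the horizontal length as a nat; it is nonnegative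
   whenever the steps are in S_MW. *)
Definition psi (p : lattice_path) : lattice_path :=
  flatten [seq psi_block p i | i <- iota 0 (absz (hlength p)).+1].

Definition bijection_with_inverse (T U : Type) (A : set T) (B : set U)
    (f : T -> U) (g : U -> T) : Prop :=
  [/\ set_bij A B f, set_fun B A g,
      {in A, cancel f g} & {in B, cancel g f}].

(* Main.v *)
Require Import Defs.

Set Implicit Arguments.
Unset Strict Implicit.
Unset Printing Implicit Defensive.

Import Order.TTheory GRing.Theory Num.Theory.

Local Open Scope classical_set_scope.
Local Open Scope ring_scope.

(** A path of odd length is cut into pairs of consecutive steps and a last step.
    On a pair [a, b] of Motzkin steps, [phi] yields [b] preceded by the vertical
    step recording the height change of [a], or by nothing if [a] is level. So
    each [b] moves the image from one vertical line to the next, and the steps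
    that [phi] produces on a given line tell which [a] they come from: this is
    what [psi] reads off. Conversely, cutting a constrained path after each of
    its horizontal moves exhibits it as an image. The only steps that [phi]
    deletes are level, so it preserves the set of heights visited. *)

Implicit Types (p q : lattice_path) (a b d e : step) (s : seq step) (z : int).

Section BijectionWithInverse.
Variables (T U : Type) (f : T -> U) (g : U -> T).
Implicit Types (A P : set T) (B Q : set U).

Lemma surj_bijection_with_inverse A B :
  set_fun A B f -> set_surj A B f -> {in A, cancel f g} ->
  bijection_with_inverse A B f g.
Proof.
move=> fAB fsurj fK; split => //.
- by split=> //; exact: can_in_inj fK.
- by move=> _ /fsurj[x Ax <-]; rewrite fK ?inE.
- by move=> y; rewrite inE => /fsurj[x Ax <-]; rewrite fK ?inE.
Qed.

Lemma bijection_with_inverse_setI A B P Q :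
  bijection_with_inverse A B f g -> (forall x, A x -> Q (f x) <-> P x) ->
  bijection_with_inverse (A `&` P) (B `&` Q) f g.
Proof.
move=> [[fAB _ fsurj] _ fK _] fPQ; apply: surj_bijection_with_inverse.
- by move=> x [Ax Px]; split; [exact: fAB | exact/fPQ].
- by move=> _ [/fsurj[x Ax <-] Qfx]; exists x => //; split=> //; apply/fPQ.
- by move=> x; rewrite inE => -[Ax _]; rewrite fK ?inE.
Qed.

End BijectionWithInverse.

Lemma seq_pair_ind (T : Type) (P : seq T -> Prop) :
  P [::] -> (forall x, P [:: x]) ->
  (forall x y (s : seq T), P s -> P [:: x, y & s]) ->
  forall s : seq T, P s.
Proof.
move=> P0 P1 P2 s; have [m] := ubnP (size s).
elim: m s => // m IHm [|x [|y s]] //= /ltnW sm.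
exact/P2/IHm.
Qed.

Lemma S_M_ind (P : step -> Prop) :
  P (1, 0) -> P (1, 1) -> P (1, -1) -> forall e, e \in S_M -> P e.
Proof. by move=> P0 P1 P2 e; rewrite !inE => /or3P[] /eqP ->. Qed.

Lemma S_M_fst e : e \in S_M -> e.1 = 1.
Proof. by elim/S_M_ind. Qed.

Lemma vertical_fst e : vertical e -> e.1 = 0.
Proof. by rewrite /vertical !inE => /orP[] /eqP ->. Qed.

Lemma S_M_nonvertical e : e \in S_M -> ~~ vertical e.
Proof. by elim/S_M_ind. Qed.

Lemma mem_S_MW e : (e \in S_MW) = (e \in S_M) || vertical e.
Proof. exact: mem_cat. Qed.

Lemma S_MW_fst_ge0 e : e \in S_MW -> 0 <= e.1.
Proof. by rewrite mem_S_MW => /orP[/S_M_fst ->|/vertical_fst ->]. Qed.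

Lemma psi_step_S_M e : vertical e -> psi_step e \in S_M.
Proof. by rewrite /vertical !inE => /orP[] /eqP ->. Qed.

Lemma psi_stepK e : vertical e -> phi_step (psi_step e) = [:: e].
Proof. by rewrite /vertical !inE => /orP[] /eqP ->. Qed.

Lemma psi_step_nonvertical e : ~~ vertical e -> psi_step e = e.
Proof.
by rewrite /vertical !inE negb_or /psi_step => /andP[/negbTE-> /negbTE->].
Qed.

Lemma phi_seq1 a : phi [:: a] = phi_step a.
Proof. by rewrite /phi /= cats0. Qed.

Lemma phi_cons2 a b p : phi [:: a, b & p] = phi_step a ++ b :: phi p.
Proof.
rewrite /phi /=; congr (_ ++ _ :: flatten _).
rewrite (iotaDl 2 1) -map_comp; apply/eq_in_map => i.
by rewrite mem_iota => /andP[i_gt0 _] /=; rewrite negbK; case: i i_gt0.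
Qed.

Lemma vertex0 p : vertex p 0 = 0.
Proof. by rewrite /vertex take0 big_nil. Qed.

Lemma vertex_consS e p k : vertex (e :: p) k.+1 = e + vertex p k.
Proof. by rewrite /vertex /= big_cons. Qed.

Lemma vertices_cons e p : vertices (e :: p) = 0 :: map (+%R e) (vertices p).
Proof.
rewrite -[LHS]/(vertex _ 0 :: map _ (iota (1 + 0) (size p).+1)) vertex0.
rewrite iotaDl -!map_comp; congr (_ :: _).
by apply: eq_map => k; exact: vertex_consS.
Qed.

Definition nonneg_from (y : int) p : bool :=
  all (fun v : int * int => 0 <= y + v.2) (vertices p).

Lemma nonneg_pathP p : reflect (nonneg_path p) (nonneg_from 0 p).
Proof. by apply: (iffP allP) => p_ge0 v /p_ge0; rewrite add0r. Qed.

Lemma nonneg_from_cons y e p :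
  nonneg_from y (e :: p) = (0 <= y) && nonneg_from (y + e.2) p.
Proof.
rewrite /nonneg_from vertices_cons -cat1s all_cat all_seq1 all_map addr0.
by congr (_ && _); apply: eq_all => v /=; rewrite addrA.
Qed.

Lemma nonneg_from_ge0 y p : nonneg_from y p -> 0 <= y.
Proof. by rewrite /nonneg_from /= vertex0 addr0 => /andP[]. Qed.

Lemma nonneg_from_phi_step y a p :
  nonneg_from y (phi_step a ++ p) = nonneg_from y (a :: p).
Proof.
rewrite /phi_step; case: eqP => [->|_]; first by rewrite /= !nonneg_from_cons.
case: eqP => [->|_]; first by rewrite /= !nonneg_from_cons.
case: eqP => [->|_] //; rewrite /= nonneg_from_cons /= addr0.
by apply/idP/andP => [yp|[]//]; split=> //; exact: nonneg_from_ge0 yp.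
Qed.

Lemma nonneg_from_phi y p : nonneg_from y (phi p) = nonneg_from y p.
Proof.
elim/seq_pair_ind: p y => [//|a|a b p IHp] y.
  by rewrite phi_seq1 -[phi_step a]cats0 nonneg_from_phi_step.
by rewrite phi_cons2 nonneg_from_phi_step !nonneg_from_cons IHp.
Qed.

Lemma nonneg_path_phi p : nonneg_path (phi p) <-> nonneg_path p.
Proof.
split=> /nonneg_pathP p_ge0; apply/nonneg_pathP.
  by rewrite -nonneg_from_phi.
by rewrite nonneg_from_phi.
Qed.

Lemma hlength_nil : hlength [::] = 0.
Proof. by rewrite /hlength vertex0. Qed.

Lemma hlength_cons e p : hlength (e :: p) = e.1 + hlength p.
Proof. by rewrite /hlength /= vertex_consS. Qed.

Lemma hlength_cat p q : hlength (p ++ q) = hlength p + hlength q.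
Proof. by rewrite /hlength /vertex !take_size big_cat. Qed.

Lemma hlength_phi_step a : a \in S_M -> hlength (phi_step a) = 0.
Proof. by elim/S_M_ind; rewrite /= ?hlength_cons hlength_nil. Qed.

Lemma hlength_phi p : all [in S_M] p -> hlength (phi p) = (size p)./2%:Z.
Proof.
elim/seq_pair_ind: p => [|a|a b p IHp] /=.
- by rewrite hlength_nil.
- by rewrite andbT phi_seq1 => /hlength_phi_step.
move=> /and3P[aM bM pM].
by rewrite phi_cons2 hlength_cat hlength_phi_step // hlength_cons S_M_fst //
  IHp // add0r intS.
Qed.

Definition not_both_vertical : rel step :=
  fun d e => ~~ (vertical d && vertical e).

Definition vertically_constrained p : bool :=
  all [in S_MW] p && sorted not_both_vertical p.

Lemma A_HP p : reflect (A_H p) (vertically_constrained p).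
Proof.
apply: (iffP andP) => -[p_steps p_vert]; split.
- exact/allP.
- move=> k kp [vk vk1]; have /(_ k kp) := sortedP 0 p_vert.
  by rewrite /not_both_vertical vk vk1.
- exact/allP.
- by apply/(sortedP 0) => k kp; apply/negP => /andP; exact: p_vert.
Qed.

Lemma vertically_constrained_cons e p :
  vertically_constrained (e :: p) =
  [&& e \in S_MW, ~~ (vertical e && vertical (head 0 p))
    & vertically_constrained p].
Proof.
rewrite /vertically_constrained /= -andbA; congr (_ && _).
by case: p => [|f p] /=; rewrite ?andbF // [RHS]andbCA.
Qed.

Lemma vertically_constrained_phi_step a p :
  a \in S_M -> vertically_constrained p -> ~~ vertical (head 0 p) ->
  vertically_constrained (phi_step a ++ p).
Proof.
by elim/S_M_ind => //= p_vc hNv; rewrite vertically_constrained_cons /= hNv.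
Qed.

Lemma vertically_constrained_phi p :
  all [in S_M] p -> vertically_constrained (phi p).
Proof.
elim/seq_pair_ind: p => [//|a|a b p IHp] /=.
  rewrite andbT phi_seq1 -[phi_step a]cats0 => aM.
  exact: vertically_constrained_phi_step.
move=> /and3P[aM bM pM]; have bNv := S_M_nonvertical bM.
rewrite phi_cons2 vertically_constrained_phi_step //.
by rewrite vertically_constrained_cons mem_S_MW bM (negbTE bNv) IHp.
Qed.

Lemma vertically_constrained_phi_surj p :
  vertically_constrained p ->
  exists q, [/\ odd (size q), all [in S_M] q & phi q = p].
Proof.
have [m] := ubnP (size p); elim: m p => // m IHm [|e p] /=.
  by exists [:: (1, 0)].
rewrite ltnS vertically_constrained_cons mem_S_MW => pm /and3P[].
have [ev _|eNv] := boolP (vertical e); last first.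
  rewrite orbF => eM _ /(IHm _ pm)[q [q_odd qM <-]].
  by exists [:: (1, 0), e & q]; rewrite /= q_odd eM qM phi_cons2.
have eM := psi_step_S_M ev.
case: p pm => [_ _ _|b p pm /= bNv].
  by exists [:: psi_step e]; rewrite /= eM phi_seq1 psi_stepK.
rewrite vertically_constrained_cons mem_S_MW (negbTE bNv) orbF => /and3P[bM _].
move=> /(IHm _ (ltnW pm))[q [q_odd qM <-]].
by exists [:: psi_step e, b & q]; rewrite /= q_odd eM bM qM phi_cons2 psi_stepK.
Qed.

Definition weakly_rightward p : bool := all (fun e : step => 0 <= e.1) p.

Lemma vertically_constrained_rightward p :
  vertically_constrained p -> weakly_rightward p.
Proof. by case/andP => + _; apply: sub_all => e /S_MW_fst_ge0. Qed.

Lemma hlength_ge0 p : weakly_rightward p -> 0 <= hlength p.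
Proof.
elim: p => [|e p IHp] /=; first by rewrite hlength_nil.
by move=> /andP[e_ge0 /IHp p_ge0]; rewrite hlength_cons addr_ge0.
Qed.

(* [steps_from] at an arbitrary integer abscissa, so that it can be translated
   along the path. *)
Definition steps_at p z : seq step :=
  [seq nth 0 p k | k <- iota 0 (size p) & (vertex p k).1 == z].

Lemma steps_at_cons e p z :
  steps_at (e :: p) z = nseq (z == 0) e ++ steps_at p (z - e.1).
Proof.
rewrite /steps_at /= vertex0 eq_sym (iotaDl 1 0) filter_map.
under eq_filter => k do rewrite /= vertex_consS addrC eq_sym -subr_eq eq_sym.
by case: eqP => _ /=; rewrite -map_comp.
Qed.

Lemma steps_at_cat p q z :
  steps_at (p ++ q) z = steps_at p z ++ steps_at q (z - hlength p).
Proof.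
elim: p z => [|e p IHp] z /=; first by rewrite hlength_nil subr0.
by rewrite !steps_at_cons IHp hlength_cons -catA opprD addrA.
Qed.

Lemma steps_at_lt0 p z : weakly_rightward p -> z < 0 -> steps_at p z = [::].
Proof.
elim: p z => // e p IHp z /= /andP[e_ge0 pR] z_lt0.
by rewrite steps_at_cons lt_eqF //= IHp // (le_lt_trans _ z_lt0) // gerBl.
Qed.

Lemma steps_at_phi_step a z :
  a \in S_M -> steps_at (phi_step a) z = if z == 0 then phi_step a else [::].
Proof. by elim/S_M_ind; rewrite /= ?steps_at_cons; case: eqP. Qed.

Lemma steps_at_phi_step_cons a b p z :
  a \in S_M -> b.1 = 1 ->
  steps_at (phi_step a ++ b :: p) z =
  (if z == 0 then phi_step a ++ [:: b] else [::]) ++ steps_at p (z - 1).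
Proof.
move=> aM b1; rewrite steps_at_cat steps_at_phi_step // hlength_phi_step //.
by rewrite subr0 steps_at_cons b1; case: eqP => //=; rewrite -catA.
Qed.

Definition psi_steps s : seq step :=
  if has vertical s then map psi_step s else (1, 0) :: s.

Lemma psi_blockE p i : psi_block p i = psi_steps (steps_at p i%:Z).
Proof. by []. Qed.

Lemma psi_steps_phi_step a s :
  a \in S_M -> ~~ has vertical s -> psi_steps (phi_step a ++ s) = a :: s.
Proof.
move=> aM sNv; have psi_s : map psi_step s = s.
  by apply: map_id_in => e /(hasPn sNv); exact: psi_step_nonvertical.
by move: a aM; apply: S_M_ind; rewrite /psi_steps /= ?(negbTE sNv) ?psi_s.
Qed.

Lemma psi_phi_step a : a \in S_M -> psi (phi_step a) = [:: a].
Proof.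
move=> aM; rewrite /psi hlength_phi_step //= cats0.
rewrite psi_blockE steps_at_phi_step //= -[phi_step a]cats0.
exact: psi_steps_phi_step.
Qed.

Lemma psi_block_phi_step_cons0 a b p :
  a \in S_M -> b.1 = 1 -> weakly_rightward p ->
  psi_block (phi_step a ++ b :: p) 0 = [:: a; b].
Proof.
move=> aM b1 pR; rewrite psi_blockE steps_at_phi_step_cons //.
rewrite steps_at_lt0 // cats0 psi_steps_phi_step //= orbF.
by apply/negP => /vertical_fst; rewrite b1.
Qed.

Lemma psi_block_phi_step_consS a b p i :
  a \in S_M -> b.1 = 1 ->
  psi_block (phi_step a ++ b :: p) i.+1 = psi_block p i.
Proof.
move=> aM b1; rewrite !psi_blockE steps_at_phi_step_cons //=.
by rewrite intS [_ - 1]addrC addKr.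
Qed.

Lemma psi_phi_step_cons a b p :
  a \in S_M -> b.1 = 1 -> weakly_rightward p ->
  psi (phi_step a ++ b :: p) = [:: a, b & psi p].
Proof.
move=> aM b1 pR; set q := phi_step a ++ b :: p.
have q_width : `|hlength q|%N = `|hlength p|.+1.
  rewrite hlength_cat hlength_phi_step // hlength_cons b1 add0r.
  by case: (hlength p) (hlength_ge0 pR).
have q_shift : psi_block q \o addn 1 =1 psi_block p.
  by move=> i; exact: psi_block_phi_step_consS.
rewrite /psi q_width -add1n iotaD (iotaDl 1 0) map_cat -map_comp flatten_cat.
by rewrite (eq_map q_shift) /= cats0 psi_block_phi_step_cons0.
Qed.

Lemma phiK p : odd (size p) -> all [in S_M] p -> psi (phi p) = p.
Proof.
elim/seq_pair_ind: p => [//|a|a b p IHp] /=.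
  by rewrite andbT phi_seq1 => _ /psi_phi_step.
rewrite negbK => p_odd /and3P[aM bM pM].
rewrite phi_cons2 psi_phi_step_cons ?S_M_fst ?IHp //.
exact/vertically_constrained_rightward/vertically_constrained_phi.
Qed.

Lemma grand_motzkin_phi_bijection n :
  bijection_with_inverse
    (grand_motzkin (2 * n + 1)) [set p | A_H p /\ hlength p = n%:Z] phi psi.
Proof.
have oddn : (2 * n + 1)%N = n.*2.+1 by rewrite addn1 mul2n.
apply: surj_bijection_with_inverse.
- move=> p [p_size /allP pM]; split.
    exact/A_HP/vertically_constrained_phi.
  by rewrite hlength_phi // p_size oddn /= uphalf_double.
- move=> _ [/A_HP/vertically_constrained_phi_surj[q [q_odd qM <-]]].
  rewrite hlength_phi // => -[qn]; exists q => //; split; last exact/allP.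
  by rewrite oddn -qn -[LHS]odd_double_half q_odd.
- move=> p; rewrite inE => -[p_size /allP pM].
  by rewrite phiK // p_size oddn /= odd_double.
Qed.

Theorem theorem7 (n : nat) :
  bijection_with_inverse
    (motzkin (2 * n + 1)) [set p | A_Q p /\ hlength p = n%:Z] phi psi /\
  bijection_with_inverse
    (grand_motzkin (2 * n + 1)) [set p | A_H p /\ hlength p = n%:Z] phi psi.
Proof.
have grand_bij := grand_motzkin_phi_bijection n; split=> //.
have -> : [set p | A_Q p /\ hlength p = n%:Z] =
          [set p | A_H p /\ hlength p = n%:Z] `&` nonneg_path.
  exact: setIAC.
apply: bijection_with_inverse_setI grand_bij _ => p _.
exact: nonneg_path_phi.
Qed.
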